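(* Let $\mathcal{H}$ be a Hilbert space, $\mathcal{L}_0\subset\mathcal{H}$ a closed subspace, $P_0$ the orthogonal projection onto $\mathcal{L}_0$, and let $U$ be a unitary operator on $\mathcal{H}$. The following are equivalent: (1) $U\in\mathbf{Sd}_{\mathcal{L}_0}$. (2) $WP_0UP_0V^*$ is Schmidt decomposable for all unitary operators $V,W$ on $\mathcal{H}$. (In particular, $U\in\mathbf{Sd}_{\mathcal{L}_0}$ if and only if $P_0UP_0U^*$ is Schmidt decomposable, and this latter operator is a product of projections.) (3) The commutator $[P_0,U]=P_0U-UP_0$ is Schmidt decomposable. (4) $U\in\mathbf{Sd}_{\mathcal{L}_0^\perp}$. (5) There exist orthonormal bases $\{f_n\}$ and $\{f'_n\}$ of $\mathcal{L}_0$ such that $\langle f_n,Uf'_m\rangle=0$ if $n\neq m$. In this case, the singular values of $P_0U|_{\mathcal{L}_0}$ are $s_n=|\langle f_n,Uf'_n\rangle|$, and the singular values of $[P_0,U]$ are the absolute values of the eigenvalues of $P_0-UP_0U^*$.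
   Context: An operator $T$ acting in a Hilbert space is called Schmidt decomposable if it has a singular value decomposition: there exist orthonormal systems $\{f_n:n\ge1\}$ and $\{g_n:n\ge1\}$ and positive numbers $s_n=s_n(T)$ (the singular values of $T$) such that $T=\sum_{n\ge1}s_n\,f_n\otimes g_n$, where $f\otimes g$ is the rank one operator $(f\otimes g)(h)=\langle h,g\rangle f$. For a closed subspace $\mathcal{L}\subset\mathcal{H}$ with orthogonal projection $P_{\mathcal{L}}$, $\mathbf{Sd}_{\mathcal{L}}$ denotes the set of unitary operators $U$ on $\mathcal{H}$ such that $P_{\mathcal{L}}U|_{\mathcal{L}}$ is Schmidt decomposable in $\mathcal{L}$ (equivalently, $P_{\mathcal{L}}UP_{\mathcal{L}}$ is Schmidt decomposable).
   Formalization: In (5) the two bases of L0 may have different index sets inside a common one (with equal ones (1) does not imply (5), e.g. the bilateral shift with L0 = l^2(N)), and s_n is taken for common n; orthonormal systems may be uncountable, and zero values are not counted as singular values. *)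

(* Defs.v *)
From HB Require Import structures.
From mathcomp Require Import all_boot all_order all_algebra.
From mathcomp Require Import complex.
From mathcomp Require Import boolp classical_sets functions cardinality fsbigop.
From mathcomp Require Import reals topology normedtype esum.

Set Implicit Arguments.
Unset Strict Implicit.
Unset Printing Implicit Defensive.

Import Order.TTheory GRing.Theory Num.Theory Num.Def.
Import numFieldNormedType.Exports.
Local Open Scope classical_set_scope.
Local Open Scope ring_scope.

(* A complex Hilbert space is a complete normed space H over R[i] with a positive
   definite hermitian form ip such that ip x x = `|x| ^+ 2 (this equation is a
   hypothesis wherever it is needed).  Following sesquilinear.v, ip is linear in
   its first argument and conjugate-linear in the second one.

   H may be non-separable, so families are indexed by a subset D of an arbitrary
   index type, and sums are unordered sums.  If H is separable, then D is
   countable as soon as it indexes an orthonormal family; a subset of nat can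
   then be used instead.

   Positive reals are elements s of R[i] with 0 < s: in R[i], the order relation
   0 < s entails that s is real. *)

Section Hilbert.
Context {R : realType} {H : completeNormedModType R[i]}.
Implicit Types (ip : {dot H for conjC}) (L : set H) (I : choiceType).

(* fsets D is the set of finite subsets of D. *)
Definition has_sum I (D : set I) (v : I -> H) (x : H) : Prop :=
  forall eps : R[i], 0 < eps ->
    exists2 A0, fsets D A0 &
      forall A, fsets D A -> A0 `<=` A -> `|x - \sum_(i \in A) v i| < eps.

Definition closed_subspace L : Prop := submod_closed [in L] /\ closed L.

Definition orthocompl ip L : set H := [set x | forall y, L y -> ip x y = 0].

(* The orthogonal projection onto L: its value at x is the p in L such that x - p
   is orthogonal to L.  Such a p is unique, and it exists for closed L; xget
   returns the default 0 otherwise. *)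
Definition orthoproj ip L (x : H) : H :=
  xget 0 [set p | L p /\ orthocompl ip L (x - p)].

Definition is_orthoproj ip (P : H -> H) : Prop :=
  exists2 L, closed_subspace L & P = orthoproj ip L.

(* The Hilbert adjoint: its value at y is the z such that <T x, y> = <x, z> for
   all x.  Such a z is unique, and it exists for bounded T; xget returns the
   default 0 otherwise. *)
Definition adjoint ip (T : H -> H) (y : H) : H :=
  xget 0 [set z | forall x, ip (T x) y = ip x z].

Definition unitary ip (U : H -> H) : Prop :=
  [/\ linear U, forall x y, ip (U x) (U y) = ip x y & forall y, exists x, U x = y].

Definition orthonormal_family ip I (D : set I) (e : I -> H) : Prop :=
  forall i j, D i -> D j -> ip (e i) (e j) = (i == j)%:R.

Definition orthonormal_basis ip L I (D : set I) (e : I -> H) : Prop :=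
  [/\ forall i, D i -> L (e i),
      orthonormal_family ip D e &
      forall x, L x -> has_sum D (fun i => ip x (e i) *: e i) x].

(* T = \sum_(i in D) s i * (f i (x) g i) as an operator in the Hilbert space L,
   where (f (x) g) h = <h, g> f; only the restriction of T to L matters.  The
   singular values need not tend to 0, so the sum is a strong (pointwise) one. *)
Definition svd ip L (T : H -> H) I (D : set I) (s : I -> R[i]) (f g : I -> H) :
    Prop :=
  [/\ forall i, D i -> 0 < s i,
      forall i, D i -> L (f i) /\ L (g i),
      orthonormal_family ip D f,
      orthonormal_family ip D g &
      forall h, L h -> has_sum D (fun i => (s i * ip h (g i)) *: f i) (T h)].

(* (s i)_(i in D) is the family of the singular values of T, regarded as an
   operator in L, repeated according to multiplicity. *)
Definition singular_values ip L (T : H -> H) I (D : set I) (s : I -> R[i]) : Prop :=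
  exists f g : I -> H, svd ip L T D s f g.

Definition singular_value ip L (T : H -> H) (t : R[i]) : Prop :=
  exists (I : choiceType) (D : set I) (s : I -> R[i]),
    singular_values ip L T D s /\ (s @` D) t.

Definition schmidt_decomposable ip L (T : H -> H) : Prop :=
  exists (I : choiceType) (D : set I) (s : I -> R[i]), singular_values ip L T D s.

Definition Sd ip L : set (H -> H) :=
  [set U | unitary ip U /\ schmidt_decomposable ip L (orthoproj ip L \o U)].

Definition is_eigenvalue (T : H -> H) (lam : R[i]) : Prop :=
  exists2 x, x != 0 & T x = lam *: x.

(* The two bases are allowed to have different index sets D and D': the defect
   spaces of the compression of U to L can have different dimensions.  For
   instance, if U is the bilateral shift on l^2(Z) and L = l^2(N), the compression
   is the unilateral shift, which is an isometry and thus Schmidt decomposable,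
   but no choice with D = D' is possible. *)
Definition diagonalizing_bases ip L (U : H -> H) I (D D' : set I) (f f' : I -> H) :
    Prop :=
  [/\ orthonormal_basis ip L D f,
      orthonormal_basis ip L D' f' &
      forall n m, D n -> D' m -> n != m -> ip (f n) (U (f' m)) = 0].

End Hilbert.

(* Main.v *)
Require Import Defs.
From HB Require Import structures.
From mathcomp Require Import all_boot all_order all_algebra.
From mathcomp Require Import complex.
From mathcomp Require Import boolp classical_sets functions cardinality fsbigop.
From mathcomp Require Import reals topology normedtype esum.
From mathcomp Require finmap.
From mathcomp Require Import ring.

Set Implicit Arguments.
Unset Strict Implicit.
Unset Printing Implicit Defensive.

Import Order.TTheory GRing.Theory Num.Theory Num.Def.
Import numFieldNormedType.Exports.
Local Open Scope classical_set_scope.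
Local Open Scope ring_scope.

(** Everything is reduced to one criterion.  Say that S is total on L if only 0
    is orthogonal, within L, to all eigenvectors of S in L ([eigen_total]).  If T
    and T' are adjoint to each other and leave L invariant, then T is Schmidt
    decomposable in L if and only if T'T is total on L ([schmidt_eigen_total]).
    Indeed the right singular vectors of T are eigenvectors of T'T, and T
    vanishes on what is orthogonal to them.  Conversely, totality makes a maximal
    orthonormal set of eigenvectors of T'T a basis of L ([eigenbasis]), and T maps
    the elements of this basis that it does not annihilate to pairwise orthogonal
    vectors.  All identities between operators are tested against vectors and
    moved across the inner product, which replaces continuity arguments.

    Totality survives unitary conjugation, the passage from S to 1 - S, the
    passage from T'T on L to TT' on M when T maps L to M ([eigen_total_swap]), and
    the passage between the whole space and two complementary reducing subspaces
    ([eigen_total_reduce]).  Write P for the projection onto L and Q for 1 - P,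
    and let primes denote adjoints.
    - The operator W P U P V' leads to V (P U' P U P) V', a unitary conjugate of
      an operator that vanishes on the complement of L and is P U' P U on L; this
      is the operator that decides about the compression ([Sd_product]).
    - Since U is unitary, P U P U' = 1 - P U Q U' on L and Q U' P U = 1 - Q U' Q U
      on the complement of L.  Two swaps therefore lead from P U' P U on L to
      Q U' Q U on the complement ([Sd_orthocompl]).
    - For the commutator C, the operator C'C is block diagonal with blocks
      1 - P U' P U and 1 - Q U' Q U ([schmidt_commutator]).
    - Bases as in the last equivalent condition are obtained by completing both
      systems of singular vectors; conversely such bases display the compression
      as a diagonal operator ([diagonalizing_bases_svd]).

    For the spectral statements, A = P - U P U' is symmetric and equals both C U'
    and U C'.  Hence A A = U C'C U' is total, and so is A, because an eigenvector
    of A A splits into eigenvectors of A ([eigen_total_sqr]).  As C U' = A, an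
    orthonormal eigenbasis e of A gives the right singular vectors U' e of C. *)

(** * Inner products and unordered sums *)

Section InnerProduct.
Context {R : realType} {H : completeNormedModType R[i]}.
Variable ip : {dot H for conjC}.

Lemma ipDl x y z : ip (x + y) z = ip x z + ip y z.
Proof. exact: (linearDl ip). Qed.

Lemma ipBl x y z : ip (x - y) z = ip x z - ip y z.
Proof. exact: (linearBl ip). Qed.

Lemma ipZl a x z : ip (a *: x) z = a * ip x z.
Proof. exact: (linearZl_LR ip). Qed.

Lemma ip0l z : ip 0 z = 0.
Proof. exact: (linear0l ip). Qed.

Lemma ipBr x y z : ip z (x - y) = ip z x - ip z y.
Proof. exact: (linearBr ip). Qed.

Lemma ipDr x y z : ip z (x + y) = ip z x + ip z y.
Proof. exact: (linearDr ip). Qed.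

Lemma ipZr a x z : ip z (a *: x) = a^* * ip z x.
Proof. exact: (linearZr_LR ip). Qed.

Lemma ip0r z : ip z 0 = 0.
Proof. exact: (linear0r ip). Qed.

Lemma ipC x y : ip x y = (ip y x)^*.
Proof. by rewrite (hermC ip) expr0 mul1r. Qed.

Lemma ip_eq0C x y : ip x y = 0 -> ip y x = 0.
Proof. by move=> xy0; rewrite ipC xy0 conjC0. Qed.

Lemma ip_eq0 x : ip x x = 0 -> x = 0.
Proof. by move=> /eqP; rewrite dnorm_eq0 => /eqP. Qed.

Lemma ip_ext x y : (forall z, ip x z = ip y z) -> x = y.
Proof.
by move=> xy; apply/subr0_eq/ip_eq0; rewrite ipBl xy subrr.
Qed.

Lemma ip_sum I (r : seq I) (v : I -> H) z :
  ip (\sum_(i <- r) v i) z = \sum_(i <- r) ip (v i) z.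
Proof. exact: (linear_sumlz ip). Qed.

Lemma pythagoras x y : ip x y = 0 -> ip (x + y) (x + y) = ip x x + ip y y.
Proof.
by move=> xy0; rewrite ipDl !ipDr xy0 (ip_eq0C xy0) addr0 add0r.
Qed.

Hypothesis ip_norm : forall x : H, ip x x = `|x| ^+ 2.

Lemma cauchy_schwarz x y : `|ip x y| <= `|x| * `|y|.
Proof.
have [->|y0] := eqVneq y 0; first by rewrite ip0r !normr0 mulr0.
(* a *: y is the projection of x onto the line of y. *)
pose a := ip x y / ip y y; have yy0 : ip y y != 0 by rewrite dnorm_eq0.
have xay0 : ip (x - a *: y) y = 0 by rewrite ipBl ipZl divfK ?subrr.
have : `|a| ^+ 2 * ip y y <= ip x x.
  rewrite -[in leRHS](subrK (a *: y) x) pythagoras; last first.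
    by rewrite ipZr xay0 mulr0.
  by rewrite ipZl ipZr mulrA -normCK lerDr ip_norm exprn_ge0.
rewrite normf_div expr_div_n !ip_norm normrX normr_id.
have ny0 : `|y| ^+ 2 != 0 by rewrite expf_neq0// normr_eq0.
have cancel (b n : R[i]) : n != 0 -> b / n ^+ 2 * n = b / n by move=> n0; field.
rewrite cancel// ler_pdivrMr ?exprn_gt0 ?normr_gt0// -exprMn.
by rewrite ler_sqr ?nnegrE ?mulr_ge0.
Qed.

Lemma near_eq0 (a : R[i]) : (forall eps, 0 < eps -> `|a| < eps) -> a = 0.
Proof.
move=> small; apply/eqP/negPn/negP => a0.
by have := small `|a|; rewrite normr_gt0 a0 ltxx => /(_ isT).
Qed.

Lemma closed_normP (K : set H) :
  closed K <->
  forall x, (forall eps : R[i], 0 < eps -> exists2 y, K y & `|x - y| < eps) ->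
    K x.
Proof.
split=> [Kc x near_x|Kc x xK].
  apply: Kc => B /nbhs_normP[e /= e0 eB].
  by have [y Ky xy] := near_x _ e0; exists y; split => //; exact: eB.
apply: Kc => eps eps0.
have [|y [Ky xy]] := xK [set y | `|x - y| < eps]; last by exists y.
by apply/nbhs_normP; exists eps.
Qed.

Lemma subspaceP (L : set H) : submod_closed [in L] ->
  [/\ L 0, forall a x, L x -> L (a *: x), forall x y, L x -> L y -> L (x + y) &
      forall x y, L x -> L y -> L (x - y)].
Proof.
case=> L0 LD; have {}L0 : L 0 by exact: set_mem L0.
have {}LD a x y : L x -> L y -> L (a *: x + y).
  by move=> Lx Ly; apply: set_mem (LD _ _ _ _ _); exact: mem_set.
split=> // [a x Lx|x y Lx Ly|x y Lx Ly].
- by rewrite -[_ *: _]addr0; exact: LD.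
- by rewrite -[x]scale1r; exact: LD.
- by rewrite addrC -scaleN1r; exact: LD.
Qed.

Lemma closed_subspaceT : closed_subspace (setT : set H).
Proof. by split; [split=> [|a x y _ _]; rewrite inE|exact: closedT]. Qed.

Lemma orthocompl_closed (L : set H) : closed_subspace (orthocompl ip L).
Proof.
split.
  split=> [|a x y]; rewrite !inE /orthocompl /=.
    by move=> y _; rewrite ip0l.
  by move=> xL yL z Lz; rewrite ipDl ipZl xL// yL// mulr0 addr0.
apply/closed_normP => x near_x z Lz; apply: near_eq0 => eps eps0.
have d0 : 0 < `|z| + 1 by rewrite ltr_wpDl.
have [y yL xy] := near_x _ (divr_gt0 eps0 d0).
rewrite -[ip x z]subr0 -(yL z Lz) -ipBl.
apply: le_lt_trans (cauchy_schwarz _ _) _.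
apply: le_lt_trans (_ : `|x - y| * (`|z| + 1) < _).
  by rewrite ler_wpM2l// lerDl.
by rewrite -ltr_pdivlMr.
Qed.

Section Sums.
Variables (I : choiceType) (D : set I).
Implicit Types (v e : I -> H) (A B : set I).

Lemma fsets_setU A B : fsets D A -> fsets D B -> fsets D (A `|` B).
Proof.
by move=> [fA AD] [fB BD]; split; [rewrite finite_setU|rewrite subUset].
Qed.

Lemma subspace_sum (L : set H) A v : submod_closed [in L] -> finite_set A ->
  (forall i, A i -> L (v i)) -> L (\sum_(i \in A) v i).
Proof.
move=> /subspaceP[L0 _ LD _] fA Lv; rewrite fsbig_finite// big_seq.
by elim/big_ind: _ => // i; rewrite in_fset_set// => /set_mem /Lv.
Qed.

Lemma ip_fsum A v z : finite_set A ->
  ip (\sum_(i \in A) v i) z = \sum_(i \in A) ip (v i) z.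
Proof. by move=> fA; rewrite !fsbig_finite// ip_sum. Qed.

(** The threshold A1 is for conditions such as a prescribed coefficient at an
    index j, which only the partial sums over sets containing j satisfy. *)
Lemma has_sum_closed (K : set H) v x A1 : closed K -> has_sum D v x ->
  fsets D A1 ->
  (forall A, fsets D A -> A1 `<=` A -> K (\sum_(i \in A) v i)) -> K x.
Proof.
move=> /closed_normP Kc vx DA1 KA; apply: Kc => eps eps0.
have [A0 DA0 xA0] := vx _ eps0.
exists (\sum_(i \in A0 `|` A1) v i); last first.
  by apply: xA0 => //; exact: fsets_setU.
by apply: KA => //; exact: fsets_setU.
Qed.

Lemma has_sum_subspace (L : set H) v x : closed_subspace L ->
  (forall i, D i -> L (v i)) -> has_sum D v x -> L x.
Proof.
move=> [Ls Lc] Lv vx; apply: (has_sum_closed Lc vx (fsets_set0 D)).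
by move=> A [fA AD] _; apply: subspace_sum => // i /AD /Lv.
Qed.

Lemma has_sum_orth v x z : has_sum D v x ->
  (forall i, D i -> ip (v i) z = 0) -> ip x z = 0.
Proof.
move=> vx vz; suff: orthocompl ip [set z] x by exact.
apply: has_sum_subspace vx; first exact: orthocompl_closed.
by move=> i Di _ ->; exact: vz.
Qed.

Variable e : I -> H.
Hypothesis eon : orthonormal_family ip D e.

Lemma ip_orthonormal_sum (c : I -> R[i]) A j : fsets D A -> A j ->
  ip (\sum_(i \in A) c i *: e i) (e j) = c j.
Proof.
move=> [fA AD] Aj; rewrite ip_fsum// fsbig_finite// (bigD1_seq j)/=; last first.
- exact: finmap.fset_uniq.
- by rewrite in_fset_set// mem_set.
rewrite ipZl eon ?eqxx ?mulr1; try exact: AD.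
rewrite big_seq_cond big1 ?addr0// => i /andP[].
rewrite in_fset_set// => /set_mem Ai /negPf ij.
by rewrite ipZl eon ?ij ?mulr0//; exact: AD.
Qed.

Lemma has_sum_coef (c : I -> R[i]) x j : has_sum D (fun i => c i *: e i) x ->
  D j -> ip x (e j) = c j.
Proof.
move=> cx Dj; apply/eqP; rewrite -subr_eq0; apply/eqP.
have -> : c j = ip (c j *: e j) (e j) by rewrite ipZl eon// eqxx mulr1.
have ej : orthocompl ip [set e j] x -> ip x (e j) = 0 by exact.
rewrite -ipBl; suff: [set x | orthocompl ip [set e j] (x - c j *: e j)] x.
  by exact.
have fj : fsets D [set j] by split => // _ ->.
apply: has_sum_closed cx fj _.
  have [_ /closed_normP clj] := orthocompl_closed [set e j].
  apply/closed_normP => y near_y; apply: clj => eps eps0.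
  have [z Kz yz] := near_y _ eps0; exists (z - c j *: e j) => //.
  by rewrite opprB addrA subrK.
move=> A DA jA _ ->; rewrite ipBl (ip_orthonormal_sum c DA (jA _ erefl)).
by rewrite ipZl eon// eqxx mulr1 subrr.
Qed.

(** * Fourier series *)

Local Notation fourier_sum x A := (\sum_(i \in A) ip x (e i) *: e i).

Lemma ip_fourier_sum_orth x y A : finite_set A ->
  (forall i, A i -> ip y (e i) = 0) -> ip (fourier_sum x A) y = 0.
Proof.
move=> fA ye; rewrite ip_fsum// fsbig1// => i /ye yi.
by rewrite ipZl (ip_eq0C yi) mulr0.
Qed.

Lemma fourier_sum_split x A A0 : fsets D A -> fsets D A0 -> A0 `<=` A ->
  `|fourier_sum x A| ^+ 2 =
  `|fourier_sum x A0| ^+ 2 + `|fourier_sum x A - fourier_sum x A0| ^+ 2.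
Proof.
move=> DA DA0 A0A; rewrite -!ip_norm -pythagoras; first by rewrite addrC subrK.
apply: ip_fourier_sum_orth => [|i A0i]; first by case: DA0.
by rewrite ipBl !ip_orthonormal_sum ?subrr//; exact: A0A.
Qed.

Lemma bessel x A : fsets D A -> `|fourier_sum x A| ^+ 2 <= `|x| ^+ 2.
Proof.
move=> DA; rewrite -!ip_norm -[in leRHS](subrK (fourier_sum x A) x) addrC.
rewrite pythagoras ?lerDl ?ip_norm ?exprn_ge0//.
apply: ip_fourier_sum_orth => [|i Ai]; first by case: DA.
by rewrite ipBl ip_orthonormal_sum ?subrr.
Qed.

(** Elements between 0 and b have no imaginary part, so that the supremum of
    the real parts serves as a supremum in R[i]. *)
Lemma bounded_adherent (E : set R[i]) b eps : E !=set0 ->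
  (forall a, E a -> 0 <= a <= b) -> 0 < eps ->
  exists2 a, E a & forall a', E a' -> a' < a + eps.
Proof.
move=> [a0 Ea0] Eb; rewrite ltcE => /andP[/eqP/= eps0 Reps0].
have supE : has_sup [set complex.Re a | a in E].
  split; first by exists (complex.Re a0); exists a0.
  by exists (complex.Re b) => _ [a /Eb/andP[_]] + <-; rewrite lecE => /andP[].
have [_ [a Ea <-] supa] := sup_adherent Reps0 supE; exists a => // a' Ea'.
have Im0 c : E c -> complex.Im c = 0 by move=> /Eb/andP[/ger0_Im].
have [Ima Ima'] := (Im0 _ Ea, Im0 _ Ea').
have a'sup : complex.Re a' <= sup [set complex.Re a | a in E].
  by apply: sup_upper_bound => //; exists a'.
rewrite ltcE; move: Ea Ea' => _ _.
move: a a' eps eps0 Reps0 supa a'sup Ima Ima'.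
move=> [a1 a2] [b1 b2] [e1 e2] /= -> _ sa sb -> ->; rewrite addr0 eqxx/=.
by apply: le_lt_trans sb _; rewrite -ltrBlDr.
Qed.

Lemma fourier_cauchy x eps : 0 < eps -> exists2 A0, fsets D A0 &
  forall A, fsets D A -> A0 `<=` A ->
    `|fourier_sum x A0 - fourier_sum x A| < eps.
Proof.
move=> eps0.
pose E := [set `|fourier_sum x A| ^+ 2 | A in fsets D].
have [| |_ [A0 DA0 <-] A0P] := bounded_adherent (b := `|x| ^+ 2) _ _
  (exprn_gt0 2 eps0) (E := E).
- by exists (`|fourier_sum x set0| ^+ 2), set0 => //; exact: fsets_set0.
- by move=> _ [A DA <-]; rewrite exprn_ge0//= bessel.
exists A0 => // A DA A0A; rewrite distrC -ltr_sqr ?nnegrE//; last exact: ltW.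
have : `|fourier_sum x A| ^+ 2 < `|fourier_sum x A0| ^+ 2 + eps ^+ 2.
  by apply: A0P; exists A.
by rewrite (fourier_sum_split x DA DA0 A0A) ltrD2l.
Qed.

(** By Bessel's inequality the squared norms of the partial Fourier sums are
    bounded, so these sums form a Cauchy net, which converges by completeness. *)
Lemma fourier_summable x :
  exists p, has_sum D (fun i => ip x (e i) *: e i) p.
Proof.
pose F := [set X : set H | exists2 A0, fsets D A0 &
  forall A, fsets D A -> A0 `<=` A -> X (fourier_sum x A)].
have FF : ProperFilter F.
  apply: Build_ProperFilter_ex => [X [A0 DA0 XA]|].
    by exists (fourier_sum x A0); exact: XA.
  split=> [|X Y [A DA XA] [B DB YB]|X Y XY [A DA XA]].
  - by exists set0 => //; exact: fsets_set0.
  - exists (A `|` B) => [|C DC]; first exact: fsets_setU.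
    by rewrite subUset => -[AC BC]; split; [exact: XA|exact: YB].
  - by exists A => // B DB AB; exact/XY/XA.
(* F is the image of the filter of large finite subsets of D. *)
have /cauchy_cvgP/cvg_ex[p Fp] : cauchy F.
  apply/cauchy_exP => eps eps0; have [A0 DA0 A0P] := fourier_cauchy x eps0.
  exists (fourier_sum x A0), A0 => // A DA A0A.
  by rewrite -ball_normE; exact: A0P.
exists p => eps eps0; have [|A0 DA0 A0P] := Fp (ball p eps).
  exact: nbhsx_ballx.
by exists A0 => // A DA A0A; have := A0P _ DA A0A; rewrite -ball_normE.
Qed.

Lemma fourierP x : exists2 p, has_sum D (fun i => ip x (e i) *: e i) p &
  forall i, D i -> ip (x - p) (e i) = 0.
Proof.
have [p xp] := fourier_summable x; exists p => // i Di.
by rewrite ipBl (has_sum_coef xp Di) subrr.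
Qed.

Lemma complete_orthonormal_basis L : closed_subspace L ->
  (forall i, D i -> L (e i)) ->
  (forall x, L x -> (forall i, D i -> ip x (e i) = 0) -> x = 0) ->
  orthonormal_basis ip L D e.
Proof.
move=> Lc Le tot; split=> // x Lx; have [p xp xpe] := fourierP x.
have [Ls _] := Lc; have [_ LZ _ LB] := subspaceP Ls.
suff /subr0_eq xE : x - p = 0 by rewrite {2}xE.
apply: tot xpe; apply: LB => //; apply: has_sum_subspace xp => // i Di.
by apply: LZ; exact: Le.
Qed.

End Sums.
End InnerProduct.

(** * Eigenbases and orthogonal projections *)

Section Operators.
Context {R : realType} {H : completeNormedModType R[i]}.
Variable ip : {dot H for conjC}.
Implicit Types (T S : H -> H) (L M : set H).

Definition adjoints T T' : Prop := forall x y, ip (T x) y = ip x (T' y).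

Lemma adjoints_sym T T' : adjoints T T' -> adjoints T' T.
Proof. by move=> TT' x y; rewrite ipC -TT' -ipC. Qed.

Lemma adjoints_linear T T' : adjoints T T' -> linear T.
Proof.
move=> TT' a x y; apply: (ip_ext (ip := ip)) => z.
by rewrite ipDl ipZl !TT' ipDl ipZl.
Qed.

Lemma adjoints_comp T1 T1' T2 T2' : adjoints T1 T1' -> adjoints T2 T2' ->
  adjoints (T1 \o T2) (T2' \o T1').
Proof. by move=> A1 A2 x y /=; rewrite A1 A2. Qed.

Lemma adjoints_sub T1 T1' T2 T2' : adjoints T1 T1' -> adjoints T2 T2' ->
  adjoints (fun x => T1 x - T2 x) (fun x => T1' x - T2' x).
Proof. by move=> A1 A2 x y /=; rewrite ipBl ipBr A1 A2. Qed.

Section LinearOperator.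
Variable T : H -> H.
Hypothesis Tlin : linear T.

Lemma linop0 : T 0 = 0.
Proof.
have := Tlin (-1) 0 0; rewrite scaler0 addr0 scaleN1r => T0.
by rewrite T0 addNr.
Qed.

Lemma linopD x y : T (x + y) = T x + T y.
Proof. by rewrite -[x]scale1r Tlin !scale1r. Qed.

Lemma linopZ a x : T (a *: x) = a *: T x.
Proof. by rewrite -[a *: x]addr0 Tlin linop0 addr0. Qed.

Lemma linopB x y : T (x - y) = T x - T y.
Proof. by rewrite addrC -scaleN1r Tlin scaleN1r addrC. Qed.

End LinearOperator.

(** For symmetric S this amounts to being diagonalizable in L ([eigenbasis]), but
    it passes through operator identities without any choice of a basis. *)
Definition eigen_total L S : Prop := forall x, L x ->
  (forall v lam, L v -> S v = lam *: v -> ip x v = 0) -> x = 0.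

Hypothesis ip_norm : forall x : H, ip x x = `|x| ^+ 2.

Lemma orthonormal_normalize (x : H) : x != 0 ->
  ip (`|x|^-1 *: x) (`|x|^-1 *: x) = 1.
Proof.
move=> x0; rewrite ip_norm normrZ normrV ?unitfE ?normr_eq0// normr_id.
by rewrite mulVf ?normr_eq0// expr1n.
Qed.

(** The spectral coefficients of an eigenvector v on an orthonormal eigenvector e
    of a symmetric S vanish unless the two eigenvalues agree; hence subtracting
    from v its Fourier sum along eigenvectors leaves an eigenvector.  This makes
    a maximal orthonormal set of eigenvectors complete. *)
Lemma eigenbasis L S : closed_subspace L -> adjoints S S ->
  eigen_total L S ->
  exists D : set H, orthonormal_basis ip L D id /\
    forall v, D v -> S v = ip (S v) v *: v.
Proof.
move=> Lc SS tot; have Slin := adjoints_linear SS.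
have [Ls _] := Lc; have [L0 LZ LD LB] := subspaceP Ls.
pose P (D : set H) := orthonormal_family ip D id /\
  forall v, D v -> L v /\ S v = ip (S v) v *: v.
have [F FP Ftot|D [[Don Deig] Dmax]] := @Zorn_bigcup _ P.
  split=> [v w [X FX Xv] [Y FY Yw]|v [X FX Xv]].
    have [XY|YX] := Ftot _ _ FX FY.
      by have [Yon _] := FP _ FY; apply: Yon => //; exact: XY.
    by have [Xon _] := FP _ FX; apply: Xon => //; exact: YX.
  by have [_] := FP _ FX; exact.
exists D; split => [|v /Deig[]//].
apply: complete_orthonormal_basis => // [v /Deig[]//|x Lx xD].
apply: tot => // v lam Lv Sv.
have [p vp vpD] := fourierP ip_norm Don v.
have Lp : L p by apply: has_sum_subspace vp => // e /Deig[Le _]; exact: LZ.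
(* Each nonzero term of the series p is an eigenvector for lam. *)
have Sp : S p = lam *: p.
  apply: (ip_ext (ip := ip)) => y; apply/subr0_eq.
  rewrite SS ipZl -[lam]conjCK -ipZr -ipBr.
  apply: (has_sum_orth ip_norm vp) => e De.
  have [_ Se] := Deig _ De; set mu := ip (S e) e in Se.
  have muJ : mu^* = mu by rewrite /mu -ipC -SS.
  rewrite /= ipBr ipZr conjCK -SS ipZl linopZ// Se !ipZl.
  have : lam * ip v e = mu * ip v e.
    by rewrite -ipZl -Sv SS Se ipZr muJ.
  move=> E; ring: E.
have [vp0|w0] := eqVneq (v - p) 0.
  rewrite (subr0_eq vp0); apply/(ip_eq0C (ip := ip)).
  apply: (has_sum_orth ip_norm vp) => e De.
  by rewrite ipZl (ip_eq0C (xD _ De)) mulr0.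
set w := v - p in vpD w0.
have Sw : S w = lam *: w by rewrite /w linopB// Sp Sv scalerBr.
pose u := `|w|^-1 *: w.
have uu : ip u u = 1 by exact: orthonormal_normalize.
have Du e : D e -> ip u e = 0 by move=> De; rewrite ipZl vpD// mulr0.
have nDu : ~ D u by move=> /Du; rewrite uu => /eqP; rewrite oner_eq0.
have [] := Dmax (D `|` [set u]).
  by split=> [y Dy|/(_ u) Du']; [left|apply/nDu/Du'; right].
split=> [y z [Dy|->] [Dz|->]|y [Dy|->]].
- exact: Don.
- by rewrite (ip_eq0C (Du _ Dy)); case: eqP => // yu; rewrite -yu in nDu.
- by rewrite Du//; case: eqP => // uz; rewrite uz in nDu.
- by rewrite eqxx uu.
- exact: Deig.
- have Su : S u = lam *: u by rewrite linopZ// Sw !scalerA mulrC.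
  split; first by apply: LZ; exact: LB.
  by rewrite Su ipZl uu mulr1.
Qed.

(** Every vector is an eigenvector of the zero operator. *)
Lemma basis_exists L : closed_subspace L ->
  exists D : set H, orthonormal_basis ip L D id.
Proof.
move=> Lc; have [|x Lx xL|D [Db _]] := @eigenbasis L (fun _ => 0) Lc.
- by move=> x y; rewrite ip0l ip0r.
- by apply/ip_eq0/(xL x 0) => //; rewrite scale0r.
- by exists D.
Qed.

Section Projection.
Variable L : set H.
Hypothesis Lc : closed_subspace L.

(** The projection is the Fourier series along a basis of L. *)
Lemma orthoproj_spec x :
  L (orthoproj ip L x) /\ orthocompl ip L (x - orthoproj ip L x).
Proof.
suff : exists p, L p /\ orthocompl ip L (x - p).
  by move=> /(xgetPex 0).
have [D [DL Don Dsum]] := basis_exists Lc.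
have [p xp xpe] := fourierP ip_norm Don x; exists p; split.
  have [Ls _] := Lc; have [_ LZ _ _] := subspaceP Ls.
  by apply: has_sum_subspace xp => // e De; apply: LZ; exact: DL.
move=> y /Dsum ysum; apply/(ip_eq0C (ip := ip)).
apply: (has_sum_orth ip_norm ysum) => e De.
by rewrite ipZl (ip_eq0C (xpe _ De)) mulr0.
Qed.

Lemma orthoproj_eq x p : L p -> orthocompl ip L (x - p) -> orthoproj ip L x = p.
Proof.
move=> Lp xp; have [LPx xPx] := orthoproj_spec x.
have [Ls _] := Lc; have [_ _ _ LB] := subspaceP Ls.
apply/subr0_eq/(ip_eq0 (ip := ip)).
have -> y : ip (orthoproj ip L x - p) y =
    ip (x - p) y - ip (x - orthoproj ip L x) y.
  by rewrite -ipBl opprB [in RHS]addrC addrA subrK.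
by rewrite xp ?xPx ?subrr//; exact: LB.
Qed.

Lemma orthoproj_in x : L (orthoproj ip L x).
Proof. by have [] := orthoproj_spec x. Qed.

Lemma orthoproj_id x : L x -> orthoproj ip L x = x.
Proof. by move=> Lx; apply: orthoproj_eq => // y _; rewrite subrr ip0l. Qed.

Lemma orthoprojK x : orthoproj ip L (orthoproj ip L x) = orthoproj ip L x.
Proof. exact/orthoproj_id/orthoproj_in. Qed.

Lemma orthoproj_orth x : orthocompl ip L x -> orthoproj ip L x = 0.
Proof.
move=> xL; have [Ls _] := Lc; have [L0 _ _ _] := subspaceP Ls.
by apply: orthoproj_eq; rewrite ?subr0.
Qed.

Lemma orthoproj_adjoints : adjoints (orthoproj ip L) (orthoproj ip L).
Proof.
move=> x y; have [LPx xPx] := orthoproj_spec x.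
have [LPy yPy] := orthoproj_spec y.
apply: (@etrans _ _ (ip (orthoproj ip L x) (orthoproj ip L y))).
  by apply/subr0_eq; rewrite -ipBr; apply/(ip_eq0C (ip := ip))/yPy.
by apply/esym/subr0_eq; rewrite -ipBl; exact: xPx.
Qed.

End Projection.

Lemma orthoproj_orthocompl L x : closed_subspace L ->
  orthoproj ip (orthocompl ip L) x = x - orthoproj ip L x.
Proof.
move=> Lc; have [LPx xPx] := orthoproj_spec Lc x.
apply: orthoproj_eq => //; first exact: orthocompl_closed.
by move=> y Ly; rewrite opprB addrC subrK; exact/(ip_eq0C (ip := ip))/Ly.
Qed.

Lemma orthocomplK L : closed_subspace L ->
  orthocompl ip (orthocompl ip L) = L.
Proof.
move=> Lc; apply/seteqP; split=> x xL; last by move=> y /(_ _ xL)/ip_eq0C.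
have [LPx xPx] := orthoproj_spec Lc x.
suff /subr0_eq -> : x - orthoproj ip L x = 0 by [].
apply: (ip_eq0 (ip := ip)); rewrite ipBl.
by rewrite xL// (ip_eq0C (xPx _ LPx)) subrr.
Qed.

End Operators.

(** * The criterion for Schmidt decomposability *)

Section SchmidtDecomposition.
Context {R : realType} {H : completeNormedModType R[i]}.
Variable ip : {dot H for conjC}.
Hypothesis ip_norm : forall x : H, ip x x = `|x| ^+ 2.
Variables (L : set H) (T T' : H -> H).
Hypothesis Lc : closed_subspace L.
Hypothesis TT' : adjoints ip T T'.
Hypothesis LT : forall x, L x -> L (T x).
Hypothesis LT' : forall x, L x -> L (T' x).

Let Tlin : linear T := adjoints_linear TT'.
Let T'lin : linear T' := adjoints_linear (adjoints_sym TT').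

Lemma gt0_conj (s : R[i]) : 0 < s -> s^* = s.
Proof. by move=> /ltW/geC0_conj. Qed.

Section SingularSystem.
Variables (I : choiceType) (D : set I) (s : I -> R[i]) (f g : I -> H).

Lemma svd_right i : svd ip L T D s f g -> D i -> T (g i) = s i *: f i.
Proof.
case=> _ Lfg fon gon Tsum Di; have /Tsum Tg : L (g i) by have [] := Lfg i Di.
have wf j : D j -> ip (T (g i) - s i *: f i) (f j) = 0.
  move=> Dj; rewrite ipBl ipZl (has_sum_coef ip_norm fon Tg Dj) gon// fon//.
  by have [->|] := eqVneq i j; rewrite ?subrr// !mulr0 subrr.
apply/subr0_eq/(ip_eq0 (ip := ip)); rewrite ipBl.
rewrite (has_sum_orth ip_norm Tg) => [|j Dj].
  by rewrite ipZl (ip_eq0C (wf _ Di)) mulr0 subrr.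
by rewrite ipZl (ip_eq0C (wf _ Dj)) mulr0.
Qed.

Lemma svd_ker h : svd ip L T D s f g -> L h ->
  (forall i, D i -> ip h (g i) = 0) -> T h = 0.
Proof.
case=> _ _ _ _ Tsum /Tsum Th hg; apply/(ip_eq0 (ip := ip)).
by apply: (has_sum_orth ip_norm Th) => i Di; rewrite hg// mulr0 scale0r ip0l.
Qed.

Hypothesis s_gt0 : forall i, D i -> 0 < s i.
Hypothesis Lf : forall i, D i -> L (f i).
Hypothesis Lg : forall i, D i -> L (g i).
Hypothesis fon : orthonormal_family ip D f.
Hypothesis gon : orthonormal_family ip D g.
Hypothesis Tg : forall i, D i -> T (g i) = s i *: f i.
Hypothesis Tker : forall h, L h -> (forall i, D i -> ip h (g i) = 0) -> T h = 0.

(** The difference of the two sides is orthogonal to g, so T annihilates it; by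
    adjunction it is then orthogonal to itself. *)
Lemma singular_left i : D i -> T' (f i) = s i *: g i.
Proof.
move=> Di; have [Ls _] := Lc; have [_ LZ _ LB] := subspaceP Ls.
have zg j : D j -> ip (T' (f i) - s i *: g i) (g j) = 0.
  move=> Dj; rewrite ipBl (adjoints_sym TT') Tg// ipZl ipZr fon// gon//.
  have [->|] := eqVneq i j; last by rewrite !mulr0 subrr.
  by rewrite gt0_conj ?subrr//; exact: s_gt0.
apply/subr0_eq/(ip_eq0 (ip := ip)); rewrite ipBr ipZr zg// mulr0.
rewrite subr0 -TT' Tker ?ip0l//.
by apply: LB; [apply/LT'/Lf|apply/LZ/Lg].
Qed.

(** By adjunction, the terms of the sum are those of the Fourier series of T h
    along f.  The remainder is orthogonal to f, hence killed by T', hence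
    orthogonal to T h as well. *)
Lemma svd_of_singular_vectors : svd ip L T D s f g.
Proof.
have [Ls _] := Lc; have [_ LZ _ LB] := subspaceP Ls.
split=> // [i Di|h Lh]; first by split; [exact: Lf|exact: Lg].
have [p Thp pf] := fourierP ip_norm fon (T h).
suff Th : T h = p.
  have eqs i : D i -> ip (T h) (f i) = s i * ip h (g i).
    by move=> Di; rewrite TT' singular_left// ipZr gt0_conj//; exact: s_gt0.
  move=> eps eps0; have [A0 DA0 A0P] := Thp _ eps0; exists A0 => // A DA A0A.
  rewrite [X in _ - X](_ : _ = \sum_(i \in A) ip (T h) (f i) *: f i).
    by rewrite {1}Th; exact: A0P.
  by apply: eq_fsbigr => i /set_mem Ai; rewrite eqs//; have [_] := DA; apply.
have Lp : L p.
  by apply: (has_sum_subspace Lc _ Thp) => i Di; apply: LZ; exact: Lf.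
set y := T h - p in pf.
have T'y : T' y = 0.
  apply: (ip_eq0 (ip := ip)); rewrite -TT' Tker ?ip0l//.
    by apply: LT'; apply: LB => //; exact: LT.
  by move=> i Di; rewrite (adjoints_sym TT') Tg// ipZr pf// mulr0.
apply/subr0_eq/(ip_eq0 (ip := ip)).
rewrite -/y {1}/y ipBl TT' T'y ip0r (has_sum_orth ip_norm Thp) ?subrr// => i Di.
by rewrite ipZl (ip_eq0C (pf _ Di)) mulr0.
Qed.

End SingularSystem.

(** The phase of c i goes into the left singular vector. *)
Lemma svd_of_basis (I : choiceType) (D1 D : set I) (c : I -> R[i])
    (f g : I -> H) :
  orthonormal_basis ip L D1 g -> D `<=` D1 -> orthonormal_family ip D f ->
  (forall i, D i -> [/\ c i != 0, L (f i) & T (g i) = c i *: f i]) ->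
  (forall i, D1 i -> ~ D i -> T (g i) = 0) ->
  svd ip L T D (fun i => `|c i|) (fun i => (c i / `|c i|) *: f i) g.
Proof.
move=> [Lg gon gsum] DD1 fon cf Tg0.
have [Ls _] := Lc; have [_ LZ _ LB] := subspaceP Ls.
apply: svd_of_singular_vectors
  => [i /cf[ci0 _ _]|i /cf[_ Lfi _]|i /DD1/Lg//|||i|].
- by rewrite normr_gt0.
- exact: LZ.
- move=> i j Di Dj; rewrite ipZl ipZr fon//.
  have [<-|] := eqVneq i j; last first.
    by rewrite !mulr0.
  have [ci0 _ _] := cf _ Di.
  rewrite mulr1 -normCK normf_div normr_id divff ?expr1n//.
  by rewrite normr_eq0.
- by move=> i j /DD1 Di /DD1 Dj; exact: gon.
- move=> /cf[ci0 _ ->]; rewrite scalerA mulrC divfK//.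
  by rewrite normr_eq0.
- move=> h Lh hg; apply: (ip_eq0 (ip := ip)); rewrite TT'.
  apply: (has_sum_orth ip_norm (gsum _ Lh)) => i D1i.
  rewrite ipZl -TT'; have [Di|nDi] := pselect (D i).
    by rewrite hg// mul0r.
  by rewrite Tg0// ip0l mulr0.
Qed.

(** If x in L is orthogonal to all eigenvectors of T'T, then it is orthogonal to
    the right singular vectors, so T x = 0 and x is itself an eigenvector. *)
Lemma schmidt_eigen_total :
  schmidt_decomposable ip L T <-> eigen_total ip L (T' \o T).
Proof.
split=> [[I [D [s [f [g Tsvd]]]]] x Lx xeig|tot].
  have Tg i (Di : D i) := svd_right Tsvd Di.
  have Tx : T x = 0.
    apply: (svd_ker Tsvd) => // i Di; have [s0 Lfg fon gon _] := Tsvd.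
    have [Lfi Lgi] := Lfg _ Di.
    apply: (xeig _ (s i * s i)) => //=; rewrite Tg// linopZ// -scalerA.
    congr (_ *: _); apply: singular_left fon gon _ _ _ Di => // j.
    - by move=> /Lfg[].
    - by move=> /Lfg[].
    - by move=> Lj; exact: svd_ker Tsvd Lj.
  by apply/(ip_eq0 (ip := ip))/(xeig x 0) => //=; rewrite Tx linop0// scale0r.
have T'T : adjoints ip (T' \o T) (T' \o T).
  exact: adjoints_comp (adjoints_sym TT') TT'.
have [D [Db Deig]] := eigenbasis ip_norm Lc T'T tot.
pose f v := `|T v|^-1 *: T v; have [DL Don _] := Db.
exists H, (D `&` [set v | T v != 0]), (fun v => `| `|T v| |).
exists (fun v => (`|T v| / `| `|T v| |) *: f v), id.
apply: svd_of_basis Db _ _ _ _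
  => [v []//|v w [Dv Tv0] [Dw Tw0]|v [Dv Tv0]|v Dv].
- have [<-|vw] := eqVneq v w; first exact: orthonormal_normalize.
  have /= T'Tw := Deig _ Dw.
  rewrite /f ipZl ipZr TT' T'Tw ipZr (Don v w)// (negPf vw).
  by rewrite !mulr0.
- have [Ls _] := Lc; have [_ LZ _ _] := subspaceP Ls.
  split; rewrite ?normr_eq0//; first by apply: LZ; apply: LT; exact: DL.
  by rewrite /f scalerA divff ?scale1r// normr_eq0.
- by move=> nTv; apply/eqP/negPn/negP => Tv0; exact: nTv.
Qed.

End SchmidtDecomposition.

(** * Operations that preserve totality of the eigenvectors *)

Section EigenTotal.
Context {R : realType} {H : completeNormedModType R[i]}.
Variable ip : {dot H for conjC}.
Hypothesis ip_norm : forall x : H, ip x x = `|x| ^+ 2.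
Implicit Types (T S : H -> H) (L M : set H).

Lemma eq_eigen_total L S S' : (forall x, L x -> S x = S' x) ->
  eigen_total ip L S -> eigen_total ip L S'.
Proof.
move=> SS' tot x Lx xeig; apply: tot => // v lam Lv Sv.
by apply: (xeig v lam) => //; rewrite -SS'.
Qed.

Lemma eigen_total_complement L S S' : (forall x, L x -> S' x = x - S x) ->
  eigen_total ip L S -> eigen_total ip L S'.
Proof.
move=> SS' tot x Lx xeig; apply: tot => // v lam Lv Sv.
by apply: (xeig _ (1 - lam)) => //; rewrite SS'// Sv scalerBl scale1r.
Qed.

Lemma eigen_total0 L S : (forall x, L x -> S x = 0) -> eigen_total ip L S.
Proof.
move=> S0 x Lx xeig; apply/(ip_eq0 (ip := ip))/(xeig x 0) => //.
by rewrite S0// scale0r.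
Qed.

(** T maps eigenvectors of T'T to eigenvectors of TT', and a vector orthogonal
    to all these images lies in the kernel of T', so it is an eigenvector of TT'
    itself. *)
Lemma eigen_total_swap L M T T' : linear T ->
  (forall x, L x -> M (T x)) -> (forall y, M y -> L (T' y)) ->
  (forall x y, L x -> M y -> ip (T x) y = ip x (T' y)) ->
  eigen_total ip L (T' \o T) -> eigen_total ip M (T \o T').
Proof.
move=> Tlin TM TL TT' tot y My yeig.
have T'y : T' y = 0.
  apply: tot; first exact: TL.
  move=> v lam Lv /= T'Tv; apply/(ip_eq0C (ip := ip)); rewrite -TT'//.
  apply/(ip_eq0C (ip := ip))/(yeig _ lam); first exact: TM.
  by rewrite /= T'Tv linopZ.
apply/(ip_eq0 (ip := ip))/(yeig y 0) => //=.
by rewrite T'y linop0// scale0r.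
Qed.

Lemma eigen_total_conj V V' S :
  adjoints ip V V' -> cancel V V' -> cancel V' V ->
  eigen_total ip setT S -> eigen_total ip setT (V \o S \o V').
Proof.
move=> VV' VK V'K tot x _ xeig.
rewrite -[x]V'K (tot (V' x)) ?(linop0 (adjoints_linear VV'))// => v lam _ Sv.
rewrite (adjoints_sym VV'); apply: (xeig _ lam) => //=.
by rewrite VK Sv (linopZ (adjoints_linear VV')).
Qed.

Lemma eigen_total_reduce L S : closed_subspace L -> linear S ->
  (forall x, orthoproj ip L (S x) = S (orthoproj ip L x)) ->
  eigen_total ip setT S <->
  eigen_total ip L S /\ eigen_total ip (orthocompl ip L) S.
Proof.
move=> Lc Slin PS; set P := orthoproj ip L in PS *.
have PP : adjoints ip P P := orthoproj_adjoints ip_norm Lc.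
have Plin := adjoints_linear PP.
have LP x : L (P x) by exact: orthoproj_in.
have QP x : orthocompl ip L (x - P x) by have [] := orthoproj_spec ip_norm Lc x.
have PL x : L x -> P x = x by exact: orthoproj_id.
split=> [tot|[totL totQ] x _ xeig].
  split=> x Lx xeig; apply: tot => // v lam _ Sv.
    by rewrite -[x]PL// PP; apply: (xeig _ lam) => //; rewrite -PS Sv linopZ.
  rewrite -[v](subrK (P v)) ipDr [ip x (P v)](Lx (P v))// addr0.
  by apply: (xeig _ lam) => //; rewrite linopB// Sv -PS Sv linopZ// scalerBr.
have Px0 : P x = 0.
  by apply: totL => // v lam Lv Sv; rewrite PP PL//; exact: (xeig _ lam).
rewrite -[x](subrK (P x)) Px0 addr0; apply: totQ; first by rewrite -{1}Px0.
by move=> v lam _ Sv; rewrite subr0; exact: (xeig _ lam).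
Qed.

(** If S (S v) = lam v and t is a square root of lam, then S v + t v and
    S v - t v are eigenvectors (or zero) whose difference is 2 t v. *)
Lemma eigen_total_sqr S : adjoints ip S S ->
  eigen_total ip setT (S \o S) -> eigen_total ip setT S.
Proof.
move=> SS tot x _ xeig; have Slin := adjoints_linear SS.
apply: tot => // v lam _ /= SSv; set t := sqrtC lam.
have lamE : lam = t * t by rewrite -expr2 sqrtCK.
have [t0|t0] := eqVneq t 0.
  apply: (xeig v 0) => //; rewrite scale0r; apply: (ip_eq0 (ip := ip)).
  by rewrite SS SSv lamE t0 mul0r scale0r ip0r.
have xw : ip x (S v + t *: v) = 0.
  apply: (xeig _ t) => //.
  by rewrite linopD// linopZ// SSv lamE scalerDr scalerA addrC.
have xw' : ip x (S v - t *: v) = 0.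
  apply: (xeig _ (- t)) => //.
  by rewrite linopB// linopZ// SSv lamE scalerBr !scaleNr scalerA opprK addrC.
have vE : v = (2 * t)^-1 *: ((S v + t *: v) - (S v - t *: v)).
  rewrite opprB addrC -addrA addKr -scalerDl scalerA.
  have -> : t + t = 2 * t by ring.
  by rewrite mulVf ?scale1r// mulf_neq0// pnatr_eq0.
by rewrite vE ipZr ipBr xw xw' subrr mulr0.
Qed.

End EigenTotal.

(** * Compressions, products and the commutator *)

Section Compressions.
Context {R : realType} {H : completeNormedModType R[i]}.
Variable ip : {dot H for conjC}.
Hypothesis ip_norm : forall x : H, ip x x = `|x| ^+ 2.
Implicit Types (T S U V W : H -> H) (L : set H).

Lemma adjointP V : unitary ip V -> adjoints ip V (adjoint ip V).
Proof.
move=> [_ Vip Vsurj] x y; have [z <-] := Vsurj y.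
have /(xgetPex 0) : exists w, [set w | forall x, ip (V x) (V z) = ip x w] w.
  by exists z => w; rewrite Vip.
exact.
Qed.

Lemma unitaryK V : unitary ip V -> cancel V (adjoint ip V).
Proof.
move=> Vu x; have [_ Vip _] := Vu; apply: (ip_ext (ip := ip)) => y.
by rewrite (adjoints_sym (adjointP Vu)) Vip.
Qed.

Lemma unitaryVK V : unitary ip V -> cancel (adjoint ip V) V.
Proof.
by move=> Vu y; have [_ _ /(_ y)[x <-]] := Vu; rewrite unitaryK.
Qed.

Lemma svd_ext L T S (I : choiceType) (D : set I) s f g :
  (forall x, L x -> T x = S x) -> svd ip L T D s f g -> svd ip L S D s f g.
Proof.
move=> TS [s0 Lfg fon gon Tsum]; split=> // h Lh.
by rewrite -TS//; exact: Tsum.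
Qed.

Lemma schmidt_ext L T S : (forall x, L x -> T x = S x) ->
  schmidt_decomposable ip L T -> schmidt_decomposable ip L S.
Proof.
move=> TS [I [D [s [f [g Tsvd]]]]].
by exists I, D, s, f, g; exact: svd_ext Tsvd.
Qed.

Lemma eigen_total_conjE V V' S :
  adjoints ip V V' -> cancel V V' -> cancel V' V ->
  eigen_total ip setT (V \o S \o V') <-> eigen_total ip setT S.
Proof.
move=> VV' VK V'K; split; last exact: eigen_total_conj.
move=> /(eigen_total_conj (adjoints_sym VV') V'K VK).
by apply: eq_eigen_total => // x _ /=; rewrite !VK.
Qed.

Section Compression.
Variables (L : set H) (U : H -> H).
Hypotheses (Lc : closed_subspace L) (Uu : unitary ip U).
Local Notation P := (orthoproj ip L).
Local Notation U' := (adjoint ip U).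

Let PP : adjoints ip P P := orthoproj_adjoints ip_norm Lc.
Let UU' : adjoints ip U U' := adjointP Uu.
Let U'U : adjoints ip U' U := adjoints_sym UU'.
Let Plin : linear P := adjoints_linear PP.
Let Ulin : linear U := adjoints_linear UU'.
Let U'lin : linear U' := adjoints_linear U'U.
Let UK : cancel U U' := unitaryK Uu.
Let U'K : cancel U' U := unitaryVK Uu.
Let LP x : L (P x) := orthoproj_in ip_norm Lc x.
Let PL x : L x -> P x = x := @orthoproj_id _ _ _ ip_norm _ Lc x.
Let PK x : P (P x) = P x := orthoprojK ip_norm Lc x.
Let PO x : orthocompl ip L x -> P x = 0 := @orthoproj_orth _ _ _ ip_norm _ Lc x.

(** On L the operators P U and P U P agree, but only the adjoint P U' P of the
    second one leaves L invariant in general. *)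
Lemma Sd_eigen_total :
  Sd ip L U <-> eigen_total ip L (fun x => P (U' (P (U (P x))))).
Proof.
have A : adjoints ip (P \o U \o P) (P \o U' \o P).
  by move=> x y /=; rewrite PP UU' PP.
have PUP x : L x -> (P \o U \o P) x = (P \o U) x.
  by move=> Lx /=; rewrite (PL Lx).
have E : schmidt_decomposable ip L (P \o U \o P) <->
    eigen_total ip L (fun x => P (U' (P (U (P x))))).
  rewrite (schmidt_eigen_total ip_norm Lc A) => [|x _|x _]; try exact: LP.
  by split; apply: eq_eigen_total => x _ /=; rewrite PK.
rewrite -E; split=> [[_]|UP]; first by apply: schmidt_ext => x /PUP.
by split=> //; apply: schmidt_ext UP.
Qed.

Lemma Sd_product V W : unitary ip V -> unitary ip W ->
  Sd ip L U <-> schmidt_decomposable ip setT (W \o P \o U \o P \o adjoint ip V).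
Proof.
move=> Vu Wu; rewrite Sd_eigen_total.
have VV' := adjointP Vu; have WW' := adjointP Wu.
set S := fun x => _.
have A : adjoints ip (W \o P \o U \o P \o adjoint ip V)
    (V \o P \o U' \o P \o adjoint ip W).
  by move=> x y /=; rewrite WW' PP UU' PP (adjoints_sym VV').
rewrite (schmidt_eigen_total ip_norm closed_subspaceT A)//.
have -> : (V \o P \o U' \o P \o adjoint ip W) \o
    (W \o P \o U \o P \o adjoint ip V) = V \o S \o adjoint ip V.
  by apply/funext => x /=; rewrite unitaryK// PK.
rewrite eigen_total_conjE//; [|exact: unitaryK|exact: unitaryVK].
rewrite (eigen_total_reduce ip_norm Lc).
- split=> [totL|[]//]; split=> //; apply: eigen_total0 => x xL.
  by rewrite /S (PO xL) !linop0.
- by move=> a x y; rewrite /S !(Plin, Ulin, U'lin).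
- by move=> x; rewrite /S !PK.
Qed.

(** The second factor U P U' projects onto the image of L under U, which is
    closed because U is isometric. *)
Lemma product_projections : exists P1 Q1 : H -> H,
  [/\ is_orthoproj ip P1, is_orthoproj ip Q1 & P \o U \o P \o U' = P1 \o Q1].
Proof.
exists P, (U \o P \o U'); split=> //; first by exists L.
pose M := [set x | L (U' x)].
have [Ls /closed_normP Lcl] := Lc; have [L0 LZ LD _] := subspaceP Ls.
have nU' x : `|U' x| = `|x|.
  apply: (pexpIrn (n := 2)); rewrite ?nnegrE//.
  by rewrite -!ip_norm U'U U'K.
have Mc : closed_subspace M.
  split.
    split=> [|a x y]; rewrite !inE /M /= ?linop0// U'lin => Lx Ly.
    by apply: LD => //; exact: LZ.
  apply/closed_normP => x near_x; apply: Lcl => eps /near_x[y My xy].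
  by exists (U' y) => //; rewrite -linopB// nU'.
exists M => //; apply/esym/funext => x /=; apply: (orthoproj_eq ip_norm Mc).
  by rewrite /M /= UK.
move=> y My; rewrite -[x in x - _]U'K -linopB// UU'.
by have [_] := orthoproj_spec ip_norm Lc (U' x); apply.
Qed.

Local Notation Q := (orthoproj ip (orthocompl ip L)).
Let QE x : Q x = x - P x := orthoproj_orthocompl ip_norm x Lc.
Let LQ x : orthocompl ip L (Q x) :=
  orthoproj_in ip_norm (orthocompl_closed ip_norm _) x.
Let QQ : adjoints ip Q Q :=
  orthoproj_adjoints ip_norm (orthocompl_closed ip_norm _).
Let Qlin : linear Q := adjoints_linear QQ.

Let LQE x : orthocompl ip L x -> Q x = x.
Proof. exact/orthoproj_id/orthocompl_closed. Qed.

(** The two complements below are P U P U' = 1 - P U Q U' on L, with factors B'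
    and B, and Q U' P U = 1 - Q U' Q U on the complement of L. *)
Lemma Sd_orthocompl : Sd ip L U ->
  eigen_total ip (orthocompl ip L) (fun x => Q (U' (Q (U (Q x))))).
Proof.
move=> /Sd_eigen_total tot.
pose T := P \o U \o P; pose T' := P \o U' \o P.
pose B := Q \o U' \o P; pose B' := P \o U \o Q.
have lin V1 V2 V3 : linear V1 -> linear V2 -> linear V3 ->
    linear (V1 \o V2 \o V3).
  by move=> l1 l2 l3 a x y /=; rewrite l3 l2 l1.
have totTT' : eigen_total ip L (T \o T').
  apply: (eigen_total_swap (L := L) (T := T) (T' := T'))
    => [|x _|x _|x y _ _|]; try exact: LP.
  - exact: lin.
  - by rewrite /T /T' /= PP UU' PP.
  - by apply: eq_eigen_total tot => x _; rewrite /T /T' /= PK.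
have totB'B : eigen_total ip L (B' \o B).
  apply: eigen_total_complement totTT' => x Lx; rewrite /B /B' /T /T' /=.
  rewrite (PL Lx) PK (LQE (LQ _)) QE.
  by rewrite (linopB Ulin) (linopB Plin) U'K (PL Lx).
have totBB' : eigen_total ip (orthocompl ip L) (B \o B').
  apply: (eigen_total_swap (T := B) (T' := B')) totB'B => [|x _|x _|x y _ _].
  - exact: lin.
  - exact: LQ.
  - exact: LP.
  - by rewrite /B /B' /= QQ U'U PP.
apply: eigen_total_complement totBB' => x Lx; rewrite /B /B' /= PK.
by rewrite (LQE Lx) [Q (U x)]QE (linopB U'lin) (linopB Qlin) UK (LQE Lx).
Qed.

Local Notation C := (fun x => P (U x) - U (P x)).
Local Notation C' := (fun x => U' (P x) - P (U' x)).

Lemma commutator_adjoints : adjoints ip C C'.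
Proof.
apply: adjoints_sub; first exact: (adjoints_comp PP UU').
exact: (adjoints_comp UU' PP).
Qed.

Lemma commutator_sqr_in x : L x -> C' (C x) = x - P (U' (P (U (P x)))).
Proof.
move=> Lx; rewrite !(PL Lx) (linopB Plin) PK subrr.
rewrite (linop0 U'lin) sub0r (linopB U'lin) (linopB Plin) UK opprB.
by rewrite (PL Lx).
Qed.

Lemma commutator_sqr_orth x : orthocompl ip L x ->
  C' (C x) = x - Q (U' (Q (U (Q x)))).
Proof.
move=> Lx; rewrite /= (PO Lx) (linop0 Ulin) subr0 PK (LQE Lx).
rewrite [Q (U x)]QE (linopB U'lin) (linopB Qlin) UK (LQE Lx) opprB.
by rewrite [x + _]addrC subrK QE.
Qed.

(** Relative to the decomposition of the space into L and its complement, the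
    diagonal blocks of the commutator vanish, so C'C is block diagonal; the two
    formulas above express its blocks by the compressions of U. *)
Lemma schmidt_commutator : schmidt_decomposable ip setT C <->
  eigen_total ip L (fun x => P (U' (P (U (P x))))) /\
  eigen_total ip (orthocompl ip L) (fun x => Q (U' (Q (U (Q x))))).
Proof.
have CC' := commutator_adjoints; have C'C := adjoints_sym CC'.
rewrite (schmidt_eigen_total ip_norm closed_subspaceT CC')//.
have lin : linear (C' \o C).
  by move=> a x y /=; rewrite (adjoints_linear CC') (adjoints_linear C'C).
rewrite (eigen_total_reduce ip_norm Lc lin) => [|x]; last first.
  rewrite -[in LHS](subrK (P x) x) (linopD lin) (linopD Plin) /=.
  rewrite commutator_sqr_orth; last by rewrite -QE.
  rewrite (commutator_sqr_in (LP x)) (linopB Plin) -QE (linopB Plin).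
  by rewrite !PK !(PO (LQ _)) subrr add0r.
split=> -[totL totQ]; split.
- apply: eigen_total_complement totL => x Lx /=.
  by rewrite commutator_sqr_in// opprB addrC subrK.
- apply: eigen_total_complement totQ => x Lx /=.
  by rewrite commutator_sqr_orth// opprB addrC subrK.
- by apply: eigen_total_complement totL => x Lx /=; exact: commutator_sqr_in.
- by apply: eigen_total_complement totQ => x Lx /=; exact: commutator_sqr_orth.
Qed.

End Compression.
End Compressions.

(** * Diagonalizing bases *)

Section Bases.
Context {R : realType} {H : completeNormedModType R[i]}.
Variable ip : {dot H for conjC}.
Hypothesis ip_norm : forall x : H, ip x x = `|x| ^+ 2.
Lemma basis_orth_eq0 (L : set H) (I : choiceType) (D : set I) (e : I -> H) x :
  orthonormal_basis ip L D e -> L x -> (forall i, D i -> ip x (e i) = 0) ->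
  x = 0.
Proof.
move=> [_ _ esum] Lx xe; apply: (ip_eq0 (ip := ip)).
apply: (has_sum_orth ip_norm (esum _ Lx)) => i Di.
by rewrite ipZl (ip_eq0C (xe _ Di)) mulr0.
Qed.

Variables (L : set H).
Hypothesis Lc : closed_subspace L.

(** The vectors added to an orthonormal family are indexed by themselves, with a
    tag b: when two families with the same index set are completed with different
    tags, no added vector of one shares its index with a vector of the other. *)
Definition extended_index {I : choiceType} (D : set I) (X : set H) (b : bool) :
    set (I + H * bool) :=
  [set k | match k with inl i => D i | inr (x, c) => c = b /\ X x end].

Definition extended_family {I : choiceType} (f : I -> H) (k : I + H * bool) : H :=
  match k with inl i => f i | inr (x, _) => x end.

Lemma orthonormal_completion (I : choiceType) (D : set I) (f : I -> H) b :
  (forall i, D i -> L (f i)) -> orthonormal_family ip D f ->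
  exists X : set H,
    (forall x, X x -> L x /\ forall i, D i -> ip x (f i) = 0) /\
    orthonormal_basis ip L (extended_index D X b) (extended_family f).
Proof.
move=> Lf fon; pose F := [set f i | i in D].
have [Fs Fc] := orthocompl_closed ip_norm F; have [Ls Lcl] := Lc.
have Nc : closed_subspace (L `&` orthocompl ip F).
  split; last exact: closedI.
  have [L0 LZ LD _] := subspaceP Ls; have [F0 FZ FD _] := subspaceP Fs.
  split=> [|a x y]; rewrite !inE; first by split.
  move=> [Lx Fx] [Ly Fy]; split; first by apply: LD (LZ _ _ _) _.
  by apply: FD (FZ _ _ _) _.
have [X Xb] := basis_exists ip_norm Nc; have [XN Xon _] := Xb.
have XL x : X x -> L x /\ forall i, D i -> ip x (f i) = 0.
  by move=> /XN[Lx Fx]; split=> // i Di; apply: Fx; exists i.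
exists X; split=> //; apply: complete_orthonormal_basis => //.
- move=> [i|[x c]] [j|[y d]] //=.
  + by move=> Di Dj; exact: fon.
  + by move=> Di [_ /XL[_ yf]]; apply/(ip_eq0C (ip := ip))/yf.
  + by move=> [_ /XL[_ xf]] Dj; rewrite xf.
  + move=> [-> Xx] [-> Xy]; rewrite (Xon x y)//; congr (_%:R).
    by congr nat_of_bool; apply/eqP/eqP => [->|[]].
- by move=> [i /Lf//|[x c] [_ /XL[]]].
- move=> x Lx xk; apply: (basis_orth_eq0 Xb).
    by split=> // _ [i Di <-]; exact: (xk (inl i)).
  by move=> y Xy; exact: (xk (inr (y, b))).
Qed.

End Bases.

Section DiagonalizingBases.
Context {R : realType} {H : completeNormedModType R[i]}.
Variable ip : {dot H for conjC}.
Hypothesis ip_norm : forall x : H, ip x x = `|x| ^+ 2.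
Variables (L : set H) (U : H -> H).
Hypotheses (Lc : closed_subspace L) (Uu : unitary ip U).
Local Notation P := (orthoproj ip L).
Local Notation U' := (adjoint ip U).
Local Notation T := (P \o U \o P).
Local Notation T' := (P \o U' \o P).

Let PP : adjoints ip P P := orthoproj_adjoints ip_norm Lc.
Let TT' : adjoints ip T T'.
Proof. by move=> x y /=; rewrite PP (adjointP Uu) PP. Qed.
Let LP x : L (P x) := orthoproj_in ip_norm Lc x.
Let PL x : L x -> P x = x.
Proof. exact: orthoproj_id. Qed.

(** Singular vectors keep their common index; the vectors added on the right lie
    in the kernel of the compression, so their tagged indices are harmless. *)
Lemma Sd_diagonalizing_bases : Sd ip L U ->
  exists (I : choiceType) (D D' : set I) (f f' : I -> H),
    diagonalizing_bases ip L U D D' f f'.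
Proof.
move=> [_ [I [D [s [f [g PUsvd]]]]]].
have Tsvd : svd ip L T D s f g.
  by apply: svd_ext PUsvd => x Lx /=; rewrite (PL Lx).
have [_ Lfg fon gon _] := PUsvd.
have [X [XL Xb]] := orthonormal_completion ip_norm Lc true
  (fun i Di => (Lfg i Di).1) fon.
have [Y [YL Yb]] := orthonormal_completion ip_norm Lc false
  (fun i Di => (Lfg i Di).2) gon.
exists (I + H * bool)%type.
exists (extended_index D X true), (extended_index D Y false).
exists (extended_family f), (extended_family g); split=> // n m Dn Dm nm.
have [XbL Xon _] := Xb; have [YbL _ _] := Yb.
rewrite -(PL (XbL _ Dn)) PP -[extended_family g m]PL; last exact: YbL.
rewrite -[P (U _)]/(T (extended_family g m)).
case: m Dm nm => [i /= Di ni|[y c] [_ /YL[Ly yg]] _] /=.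
  have /= -> := svd_right ip_norm Tsvd Di.
  by rewrite ipZr (Xon n (inl i))// (negPf ni) mulr0.
by have /= -> := svd_ker ip_norm Tsvd Ly yg; rewrite ip0r.
Qed.

(** Expanding the image of f' n along f leaves only the term of index n, so the
    compression maps f' n to c n *: f n, or to 0 if n is not in D. *)
Lemma diagonalizing_bases_svd (I : choiceType) (D D' : set I) (f f' : I -> H) :
  diagonalizing_bases ip L U D D' f f' ->
  singular_values ip L (P \o U)
    [set n | [/\ D n, D' n & ip (f n) (U (f' n)) != 0]]
    (fun n => `|ip (f n) (U (f' n))|).
Proof.
move=> [fb f'b fUf']; set D0 := [set n | _].
have [Lf fon _] := fb; have [Lf' _ _] := f'b.
have [Ls _] := Lc; have [_ LZ _ LB] := subspaceP Ls.
pose c n := ip (U (f' n)) (f n).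
have Tf' m n : D n -> D' m -> ip (T (f' m)) (f n) = (m == n)%:R * c n.
  move=> Dn Dm; rewrite /= PP (PL (Lf _ Dn)) (PL (Lf' _ Dm)).
  have [->|mn] := eqVneq m n; first by rewrite mul1r.
  by rewrite mul0r; apply/(ip_eq0C (ip := ip))/fUf'; rewrite // eq_sym.
have -> : (fun n => `|ip (f n) (U (f' n))|) = (fun n => `|c n|).
  by apply/funext => n; rewrite ipC norm_conjC.
exists (fun n => (c n / `|c n|) *: f n), f'.
apply: (svd_ext (T := T)) => [x Lx /=|]; first by rewrite (PL Lx).
apply: (svd_of_basis ip_norm Lc TT' _ _ f'b) => [x _|x _|n []//|m n|n|n] /=.
- exact: LP.
- exact: LP.
- by move=> [Dm _ _] [Dn _ _]; exact: fon.
- move=> [Dn D'n fUn]; split; first by rewrite /c ipC conjC_eq0.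
    exact: Lf.
  apply/subr0_eq/(basis_orth_eq0 ip_norm fb).
    by apply: LB; [exact: LP|apply: LZ; exact: Lf].
  move=> m Dm; rewrite ipBl (Tf' n m)// ipZl fon//.
  by have [->|] := eqVneq n m; rewrite ?mul1r ?mulr1 ?mul0r ?mulr0 subrr.
- move=> D'n nD0; apply: (basis_orth_eq0 ip_norm fb); first exact: LP.
  move=> m Dm; rewrite (Tf' n m)//.
  have [nm|] := eqVneq n m; last by rewrite mul0r.
  rewrite mul1r; apply/eqP/negPn/negP => cm; apply: nD0; split=> //; rewrite nm//.
  by rewrite ipC conjC_eq0.
Qed.

End DiagonalizingBases.

(** * Singular values of the commutator *)

Section CommutatorSpectrum.
Context {R : realType} {H : completeNormedModType R[i]}.
Variable ip : {dot H for conjC}.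
Hypothesis ip_norm : forall x : H, ip x x = `|x| ^+ 2.
Variables (L : set H) (U : H -> H).
Hypotheses (Lc : closed_subspace L) (Uu : unitary ip U).
Local Notation P := (orthoproj ip L).
Local Notation U' := (adjoint ip U).
Local Notation C := (fun x => P (U x) - U (P x)).
Local Notation C' := (fun x => U' (P x) - P (U' x)).
Local Notation A := (fun x => P x - U (P (U' x))).

Let PP : adjoints ip P P := orthoproj_adjoints ip_norm Lc.
Let UU' : adjoints ip U U' := adjointP Uu.
Let Ulin : linear U := adjoints_linear UU'.
Let CC' : adjoints ip C C' := commutator_adjoints ip_norm Lc Uu.

Lemma projection_difference_adjoints : adjoints ip A A.
Proof. by move=> x y /=; rewrite ipBl ipBr PP UU' PP (adjoints_sym UU'). Qed.

Lemma projection_differenceE x : A x = C (U' x).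
Proof. by rewrite /= unitaryVK. Qed.

Lemma projection_differenceE' x : A x = U (C' x).
Proof. by rewrite /= (linopB Ulin) unitaryVK. Qed.

Lemma schmidt_commutator_eigen_total :
  schmidt_decomposable ip setT C -> eigen_total ip setT A.
Proof.
move=> /(schmidt_eigen_total ip_norm closed_subspaceT CC') => /(_ _ _)CC.
apply: eigen_total_sqr; first exact: projection_difference_adjoints.
have -> : A \o A = U \o (C' \o C) \o U'.
  apply/funext => x.
  by rewrite /= -projection_differenceE' -projection_differenceE.
apply: eigen_total_conj; [exact: UU'|exact: unitaryK|exact: unitaryVK|].
exact: CC.
Qed.

(** Since C (U' x) = A x, the family U' \o e is a basis that C maps to multiples
    of e. *)
Lemma commutator_singular_values (I : choiceType) (D : set I) (e : I -> H)
    (lam : I -> R[i]) :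
  orthonormal_basis ip setT D e -> (forall n, D n -> A (e n) = lam n *: e n) ->
  singular_values ip setT C [set n | D n /\ lam n != 0] (fun n => `|lam n|).
Proof.
move=> eb Ae; have [_ eon _] := eb.
have [_ Uip _] := Uu.
exists (fun n => (lam n / `|lam n|) *: e n), (fun n => U' (e n)).
apply: (svd_of_basis ip_norm closed_subspaceT CC' _ _ (D1 := D)) => //.
- apply: complete_orthonormal_basis => // [i j Di Dj||x _ xe].
  + by rewrite -Uip !unitaryVK//; exact: eon.
  + exact: closed_subspaceT.
  rewrite -[x](unitaryK Uu).
  rewrite (_ : U x = 0) ?(linop0 (adjoints_linear (adjoints_sym UU')))//.
  apply: (basis_orth_eq0 ip_norm eb) => // i Di.
  by rewrite UU' xe.
- by move=> n [].
- by move=> i j [Di _] [Dj _]; exact: eon.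
- by move=> n [Dn lamn]; split=> //; rewrite -projection_differenceE Ae.
- move=> n Dn nDn; rewrite -projection_differenceE Ae//.
  have [->|lamn] := eqVneq (lam n) 0; first by rewrite scale0r.
  by case: nDn.
Qed.

(** A left singular vector f satisfies A (A f) = s ^+ 2 *: f, so either
    A f + s *: f is an eigenvector for s, or it is 0 and f is one for - s. *)
Lemma singular_value_eigenvalue t : singular_value ip setT C t ->
  exists lam, [/\ is_eigenvalue A lam, lam != 0 & t = `|lam|].
Proof.
move=> [I [D [s [[f [g Csvd]] [i Di <-]]]]].
have [s0 _ fon gon _] := Csvd; have si0 := s0 _ Di.
have Cg j : D j -> C (g j) = s j *: f j := svd_right ip_norm Csvd.
have C'f : C' (f i) = s i *: g i.
  apply: (singular_left closed_subspaceT CC' _ s0 _ _ fon gon Cg _ Di) => //.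
  by move=> h Lh; exact: svd_ker Csvd Lh.
have AA : A (A (f i)) = (s i * s i) *: f i.
  have -> : A (f i) = U (s i *: g i) by rewrite projection_differenceE' C'f.
  rewrite projection_differenceE unitaryK// -scalerA -Cg//.
  exact: (linopZ (adjoints_linear CC')).
have Alin := adjoints_linear projection_difference_adjoints.
have fi0 : f i != 0.
  apply/eqP => fi0; have := fon _ _ Di Di.
  by rewrite fi0 ip0l eqxx => /esym/eqP; rewrite oner_eq0.
have si_neq0 : s i != 0 by rewrite gt_eqF.
have [w0|w0] := eqVneq (A (f i) + s i *: f i) 0.
  exists (- s i); rewrite oppr_eq0 normrN gtr0_norm//; split=> //.
  by exists (f i) => //; rewrite scaleNr; apply/eqP; rewrite -addr_eq0 w0.
exists (s i); rewrite gtr0_norm//; split=> //.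
exists (A (f i) + s i *: f i) => //.
apply: etrans (linopD Alin _ _) _; rewrite AA.
apply: etrans (congr1 _ (linopZ Alin _ _)) _.
by rewrite [RHS]scalerDr scalerA addrC.
Qed.

(** An eigenvector for lam is not orthogonal to some element of an eigenbasis,
    whose eigenvalue is then the conjugate of lam, as A is symmetric. *)
Lemma eigenvalue_singular_value lam : schmidt_decomposable ip setT C ->
  is_eigenvalue A lam -> lam != 0 -> singular_value ip setT C `|lam|.
Proof.
move=> Csd [x x0 Ax] lam0; have AA := projection_difference_adjoints.
have [D [Db Deig]] := eigenbasis ip_norm closed_subspaceT AA
  (schmidt_commutator_eigen_total Csd).
have [e De xe] : exists2 e, D e & ip x e != 0.
  apply: contrapT => nxe; move/eqP: x0; apply.
  apply: (basis_orth_eq0 ip_norm Db) => // e De; apply/eqP/negPn/negP => xe.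
  by apply: nxe; exists e.
have lamE : lam = (ip (A e) e)^*.
  apply: (mulIf xe); rewrite -[LHS]ipZl -Ax; apply: etrans (AA x e) _.
  by apply: etrans (congr1 _ (Deig _ De)) _; rewrite ipZr.
exists H, [set v | D v /\ ip (A v) v != 0], (fun v => `|ip (A v) v|); split.
  exact: commutator_singular_values Db Deig.
exists e; last by rewrite lamE norm_conjC.
by split=> //; rewrite -conjC_eq0 -lamE.
Qed.

End CommutatorSpectrum.

(** * The theorem *)

Theorem corollary2p2 (R : realType) (H : completeNormedModType R[i])
    (ip : {dot H for conjC}) (ip_norm : forall x : H, ip x x = `|x| ^+ 2)
    (L0 : set H) (L0_closed : closed_subspace L0)
    (U : H -> H) (U_unitary : unitary ip U) :
  let P0 := orthoproj ip L0 in
  let U' := adjoint ip U in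
  let C := fun x => P0 (U x) - U (P0 x) in
  let A := fun x => P0 x - U (P0 (U' x)) in
  [/\ [<-> Sd ip L0 U;
           forall V W : H -> H, unitary ip V -> unitary ip W ->
             schmidt_decomposable ip setT (W \o P0 \o U \o P0 \o adjoint ip V);
           schmidt_decomposable ip setT C;
           Sd ip (orthocompl ip L0) U;
           exists (I : choiceType) (D D' : set I) (f f' : I -> H),
             diagonalizing_bases ip L0 U D D' f f'],
      Sd ip L0 U <-> schmidt_decomposable ip setT (P0 \o U \o P0 \o U'),
      exists P Q : H -> H,
        [/\ is_orthoproj ip P, is_orthoproj ip Q & P0 \o U \o P0 \o U' = P \o Q] &
      Sd ip L0 U ->
        [/\ forall (I : choiceType) (D D' : set I) (f f' : I -> H),
              diagonalizing_bases ip L0 U D D' f f' ->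
              singular_values ip L0 (P0 \o U)
                [set n | [/\ D n, D' n & ip (f n) (U (f' n)) != 0]]
                (fun n => `|ip (f n) (U (f' n))|),
            exists (I : choiceType) (D : set I) (e : I -> H) (lam : I -> R[i]),
              orthonormal_basis ip setT D e /\
              forall n, D n -> A (e n) = lam n *: e n,
            forall (I : choiceType) (D : set I) (e : I -> H) (lam : I -> R[i]),
              orthonormal_basis ip setT D e ->
              (forall n, D n -> A (e n) = lam n *: e n) ->
              singular_values ip setT C [set n | D n /\ lam n != 0]
                (fun n => `|lam n|) &
            forall t : R[i], singular_value ip setT C t <->
              exists lam, [/\ is_eigenvalue A lam, lam != 0 & t = `|lam|]]].
Proof.
move=> P0 U' C A.
have Lperp := orthocompl_closed ip_norm L0.
have id_unitary : unitary ip (@id H) by split=> // y; exists y.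
have Csd : schmidt_decomposable ip setT C <->
    Sd ip L0 U /\ Sd ip (orthocompl ip L0) U.
  rewrite (schmidt_commutator ip_norm L0_closed U_unitary).
  rewrite -(Sd_eigen_total ip_norm L0_closed U_unitary).
  by rewrite -(Sd_eigen_total ip_norm Lperp U_unitary).
have Sd_perp L : closed_subspace L -> Sd ip L U -> Sd ip (orthocompl ip L) U.
  move=> Lc /(Sd_orthocompl ip_norm Lc U_unitary).
  by rewrite -Sd_eigen_total//; exact: orthocompl_closed.
have Sd_C : Sd ip L0 U -> schmidt_decomposable ip setT C.
  by move=> SdU; apply/Csd; split=> //; exact: Sd_perp.
split.
- tfae.
  + move=> SdU V W Vu Wu.
    by apply/(Sd_product ip_norm L0_closed U_unitary Vu Wu).
  + move=> /(_ _ _ id_unitary id_unitary).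
    by move=> /(Sd_product ip_norm L0_closed U_unitary id_unitary id_unitary).
  + by move=> /Csd[].
  + move=> /(Sd_perp _ Lperp); rewrite orthocomplK//.
    exact: Sd_diagonalizing_bases.
  + move=> [I [D [D' [f [f' ff']]]]]; split=> //.
    exists I, [set n | [/\ D n, D' n & ip (f n) (U (f' n)) != 0]].
    by eexists; exact: diagonalizing_bases_svd.
- exact: (Sd_product ip_norm L0_closed U_unitary U_unitary id_unitary).
- exact: product_projections.
move=> SdU; have SdC := Sd_C SdU; split.
- by move=> I D D' f f'; exact: diagonalizing_bases_svd.
- have [D [Db Deig]] := eigenbasis ip_norm closed_subspaceT
    (projection_difference_adjoints ip_norm L0_closed U_unitary)
    (schmidt_commutator_eigen_total ip_norm L0_closed U_unitary SdC).
  by exists H, D, id, (fun v => ip (A v) v).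
- by move=> I D e lam; exact: commutator_singular_values.
- move=> t; split; first exact: singular_value_eigenvalue.
  by move=> [lam [Alam lam0 ->]]; exact: eigenvalue_singular_value.
Qed.
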